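(* Let $\mathcal V$ be a commutative nil-variety of semigroups that is a modular element of the lattice $\mathbf{Com}$ of all commutative semigroup varieties. Then $\mathcal V$ may be given within the variety $\mathcal{COM}$ of all commutative semigroups by $0$-reduced and substitutive identities only; that is, there is a set $\Sigma$ of identities, each of which is $0$-reduced or substitutive, such that $\mathcal V$ is the class of all commutative semigroups satisfying $\Sigma$.
   Context: A semigroup variety is a class of semigroups defined by a set of semigroup identities (pairs of nonempty words $u=v$ over a countably infinite alphabet). $\mathbf{Com}$ is the lattice (under inclusion) of all varieties consisting of commutative semigroups; meet is intersection and join is the least variety containing both. For a word $w$, the symbolic identity $w=0$ abbreviates the pair of identities $wx=xw=w$ where $x$ is a letter not occurring in $w$; identities of the form $w=0$ are called $0$-reduced. An identity $u=v$ is called substitutive if the words $u$ and $v$ depend on the same letters (the sets of letters occurring in $u$ and in $v$ coincide) and $v$ may be obtained from $u$ by renaming of letters. A semigroup variety is a nil-variety if it consists of nil-semigroups; equivalently, it satisfies $x^n=0$ for some natural $n$. An element $x$ of a lattice $L$ is modular if for all $y,z\in L$ with $y\le z$ one has $(x\vee y)\wedge z=(x\wedge z)\vee y$. *)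

(* Defs.v *)
From HB Require Import structures.
From mathcomp Require Import all_boot all_order.
From mathcomp Require Import boolp classical_sets.

Set Implicit Arguments.
Unset Strict Implicit.
Unset Printing Implicit Defensive.

Import Order.TTheory.

Local Open Scope classical_set_scope.

(* MathComp's [semigroupType] is not used: it lives in a universe too large   *)
(* for classes of such structures to form a [set] or a [latticeType], it      *)
(* carries a choice structure, and it allows an empty carrier.                *)
Record semigroup := MkSemigroup {
  carrier :> Type;
  sop : carrier -> carrier -> carrier;
  sopA : associative sop;
  carrier_inhabited : inhabited carrier }.

(* [spow x n] is the power of [x] with exponent [n.+1].                       *)
Definition spow (S : semigroup) (x : S) (n : nat) : S := iter n (sop x) x.

Definition is_zero (S : semigroup) (z : S) : Prop :=
  forall x : S, sop x z = z /\ sop z x = z.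

Definition nil_semigroup (S : semigroup) : Prop :=
  exists2 z : S, is_zero z & forall x : S, exists n, spow x n = z.

(* Words over the alphabet [nat]; they are nonempty, hence given by a first   *)
(* letter and the list of the remaining ones.                                 *)
Record word := Word { whead : nat; wtail : seq nat }.

Definition letters (w : word) : seq nat := whead w :: wtail w.

Definition wletter (x : nat) : word := Word x [::].

Definition wcat (u v : word) : word := Word (whead u) (wtail u ++ letters v).

Definition wmap (r : nat -> nat) (w : word) : word :=
  Word (r (whead w)) (map r (wtail w)).

Definition weval (S : semigroup) (f : nat -> S) (w : word) : S :=
  foldl (fun a x => sop a (f x)) (f (whead w)) (wtail w).

Lemma weval_cat (S : semigroup) (f : nat -> S) (u v : word) :
  weval f (wcat u v) = sop (weval f u) (weval f v).
Proof.
case: u v => [x s] [y t]; rewrite /weval /= foldl_cat /=.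
elim/last_ind: t => [|t z IH] //=.
by rewrite -!cats1 !foldl_cat /= IH sopA.
Qed.

Definition identity : Type := (word * word)%type.

Definition satisfies (S : semigroup) (e : identity) : Prop :=
  forall f : nat -> S, weval f e.1 = weval f e.2.

Definition Mod (E : set identity) : set semigroup :=
  [set S | forall e, E e -> satisfies S e].

Definition is_variety (V : set semigroup) : Prop :=
  exists E : set identity, V = Mod E.

Definition COM : set semigroup := [set S | commutative (@sop S)].

Definition nil_class (V : set semigroup) : Prop := V `<=` nil_semigroup.

(* [Zero w] is the symbolic identity [w = 0]; being an abbreviation for       *)
(* several identities, it is kept apart from the plain identities [Id e].     *)
Inductive symbolic_identity := Id of identity | Zero of word.

Definition expand (s : symbolic_identity) : set identity :=
  match s with
  | Id e => [set e]
  | Zero w => [set e | exists2 x, x \notin letters w &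
                 e = (wcat w (wletter x), w) \/ e = (wcat (wletter x) w, w)]
  end.

Definition zero_reduced (s : symbolic_identity) : Prop :=
  exists w, s = Zero w.

Definition substitutive (s : symbolic_identity) : Prop :=
  exists u v : word, [/\ s = Id (u, v), letters u =i letters v &
    exists2 r : nat -> nat, {in letters u &, injective r} & v = wmap r u].

Definition modular_element d (L : latticeType d) (x : L) : Prop :=
  forall y z : L, (y <= z)%O -> ((x `|` y) `&` z = (x `&` z) `|` y)%O.

(* [W] ranges over all varieties; [COM] is one of them, so the join of two    *)
(* commutative varieties is commutative ([variety_join_com]).                 *)
Definition variety_join (X Y : set semigroup) : set semigroup :=
  \bigcap_(W in [set W | [/\ is_variety W, X `<=` W & Y `<=` W]]) W.

Record comVariety := ComVariety {
  cv_class :> set semigroup;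
  cv_variety : is_variety cv_class;
  cv_com : cv_class `<=` COM }.

Lemma cv_class_inj (X Y : comVariety) : X = Y :> set semigroup -> X = Y.
Proof.
case: X Y => [X vX cX] [Y vY cY] /= eXY; subst Y.
by rewrite (Prop_irrelevance vX vY) (Prop_irrelevance cX cY).
Qed.

Lemma COM_is_variety : is_variety COM.
Proof.
exists [set (Word 0 [:: 1], Word 1 [:: 0])]; apply/seteqP; split=> S cS.
  by move=> _ -> f; exact: cS.
by move=> x y; exact: (cS _ erefl (fun n => if n is 0 then x else y)).
Qed.

Lemma setI_is_variety (X Y : set semigroup) :
  is_variety X -> is_variety Y -> is_variety (X `&` Y).
Proof.
move=> [E ->] [F ->]; exists (E `|` F); apply/seteqP; split=> S.
  by move=> [hE hF] e [/hE|/hF].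
by move=> h; split=> e he; apply: h; [left|right].
Qed.

Lemma variety_join_is_variety (X Y : set semigroup) :
  is_variety (variety_join X Y).
Proof.
pose E := [set e | forall S, (X `|` Y) S -> satisfies S e].
exists E; apply/seteqP; split=> S h.
  by apply: h; split; [exists E | move=> T XT e; apply; left
                                | move=> T YT e; apply; right].
move=> W [[F ->] hX hY] e Fe; apply: h => T.
by case=> [/hX|/hY]; apply.
Qed.

Lemma setI_com (X Y : comVariety) : X `&` Y `<=` COM.
Proof. by move=> S [XS _]; exact: cv_com XS. Qed.

Lemma variety_join_com (X Y : comVariety) : variety_join X Y `<=` COM.
Proof.
by move=> S; apply; split; [exact: COM_is_variety | exact: cv_com ..].
Qed.

Definition cv_meet (X Y : comVariety) : comVariety :=
  ComVariety (setI_is_variety (cv_variety X) (cv_variety Y))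
             (@setI_com X Y).

Definition cv_join (X Y : comVariety) : comVariety :=
  ComVariety (variety_join_is_variety X Y) (@variety_join_com X Y).

Definition cv_le (X Y : comVariety) : bool := `[< X `<=` Y >].

Fact cv_le_refl : reflexive cv_le.
Proof. by move=> X; apply/asboolP. Qed.

Fact cv_le_anti : antisymmetric cv_le.
Proof.
move=> X Y /andP[/asboolP XY /asboolP YX].
by apply: cv_class_inj; apply/seteqP.
Qed.

Fact cv_le_trans : transitive cv_le.
Proof.
by move=> Y X Z /asboolP XY /asboolP YZ; apply/asboolP; exact: subset_trans YZ.
Qed.

Fact comVariety_display : Order.disp_t.
Proof. exact: Order.Disp tt tt. Qed.

HB.instance Definition _ := gen_eqMixin comVariety.
HB.instance Definition _ := gen_choiceMixin comVariety.
HB.instance Definition _ := Order.Le_isPOrder.Build comVariety_display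
  comVariety cv_le_refl cv_le_anti cv_le_trans.

Fact cv_meetP (X Y Z : comVariety) :
  (X <= cv_meet Y Z)%O = (X <= Y)%O && (X <= Z)%O.
Proof.
apply/asboolP/andP => [h|[/asboolP XY /asboolP XZ]].
  by split; apply/asboolP => S /h[].
by move=> S XS; split; [exact: XY | exact: XZ].
Qed.

Fact cv_joinP (X Y Z : comVariety) :
  (cv_join X Y <= Z)%O = (X <= Z)%O && (Y <= Z)%O.
Proof.
apply/asboolP/andP => [h|[/asboolP XZ /asboolP YZ]].
  by split; apply/asboolP => S hS; apply: h => W [_ XW YW];
     [exact: XW | exact: YW].
by move=> S; apply; split; first exact: cv_variety.
Qed.

HB.instance Definition _ := Order.POrder_MeetJoin_isLattice.Build
  comVariety_display comVariety cv_meetP cv_joinP.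

Lemma cv_leP (X Y : comVariety) : reflect (X `<=` Y) (X <= Y)%O.
Proof. exact: asboolP. Qed.

Lemma cv_meetE (X Y : comVariety) : (X `&` Y)%O = X `&` Y :> set semigroup.
Proof. by []. Qed.

Lemma cv_joinE (X Y : comVariety) :
  (X `|` Y)%O = variety_join X Y :> set semigroup.
Proof. by []. Qed.

(* Main.v *)
(* Let V satisfy u = v with u nonzero in V, and let x^(N+1) = 0 in V. Suppose *)
(* that no multiple of a substitution instance of u equals v up to            *)
(* commutativity, and put Z = Mod(u = u^(N+2)), Y = Z meet Mod(v = v^(N+2))   *)
(* within COM. Then V meet Z satisfies v = u = u^(N+2) = 0 = v^(N+2), so      *)
(* modularity makes v = v^(N+2) hold in (V join Y) meet Z. But the semigroup  *)
(* of divisors of v with a zero adjoined lies in that variety and refutes the *)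
(* identity: an identity of V join Y holds in the proper divisors of v, which *)
(* handles all values except v itself, and in the cyclic group of order N+1,  *)
(* which determines the exponents of a word that is nonzero in V. So v is a   *)
(* multiple of an instance of u; a longer v would iterate to arbitrarily long *)
(* nonzero words on the same letters, hence v is a renaming of u.             *)

Require Import Defs.
From mathcomp Require Import all_boot all_order.
From mathcomp Require Import boolp classical_sets.

Set Implicit Arguments.
Unset Strict Implicit.
Unset Printing Implicit Defensive.

Local Open Scope classical_set_scope.

(** Take for [Sigma] all 0-reduced and substitutive identities of V. Each identity u = v of V must
    follow from them and commutativity. If u is zero in V, so is v, and [Sigma] makes both sides
    zero. Otherwise modularity gives [modular_embeds]: up to commutativity, v is a multiple of an
    instance g(u). Nilpotency bounds the length of words equal to u in V ([holds_size_bound]), so v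
    cannot be longer than u ([embeds_size]). Hence g only renames letters ([embeds_renaming]), and u
    = v is substitutive up to the order of letters in v.

    The core of [modular_embeds] is [divisors_satisfies]: an identity that holds in V, in the proper
    divisors of v and in the cyclic group of order N+1 holds in the divisors of v. Exponents are
    shifted throughout: [spow x N] is x^(N+1) and [wpow u N.+1] is u^(N+2). *)

(** * Words, substitution and multiplicities *)

Lemma word_ind_r (Q : word -> Prop) :
  (forall x, Q (wletter x)) ->
  (forall w x, Q w -> Q (wcat w (wletter x))) -> forall w, Q w.
Proof.
move=> Q1 Qcat [x s]; elim/last_ind: s => [|s y IH]; first exact: Q1.
by rewrite -cats1; exact: Qcat (Word x s) y IH.
Qed.

Lemma letters_cat u v : letters (wcat u v) = letters u ++ letters v.
Proof. by []. Qed.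

Lemma wcatA : associative wcat.
Proof. by move=> u v w; rewrite /wcat /letters /= -catA. Qed.

(** The free semigroup: substitutions and powers of words become instances of [weval] and [spow]. *)
Definition word_semigroup := MkSemigroup wcatA (inhabits (wletter 0)).

Definition wsubst (g : nat -> word) (w : word) : word :=
  weval (S := word_semigroup) g w.

Lemma wsubst_cat g u v : wsubst g (wcat u v) = wcat (wsubst g u) (wsubst g v).
Proof. exact: (weval_cat (S := word_semigroup)). Qed.

Lemma letters_subst g w :
  letters (wsubst g w) = flatten [seq letters (g x) | x <- letters w].
Proof.
elim/word_ind_r: w => [x|w x IH]; first by rewrite /= cats0.
by rewrite wsubst_cat !letters_cat map_cat flatten_cat -IH /= cats0.
Qed.

Lemma weval_subst (S : semigroup) (f : nat -> S) g w :
  weval f (wsubst g w) = weval (fun x => weval f (g x)) w.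
Proof.
elim/word_ind_r: w => [x|w x IH] //.
by rewrite wsubst_cat !weval_cat IH.
Qed.

Lemma eq_in_weval (S : semigroup) (f g : nat -> S) w :
  {in letters w, f =1 g} -> weval f w = weval g w.
Proof.
elim/word_ind_r: w => [x|w x IH] fg; first by apply: fg; exact: mem_head.
rewrite !weval_cat IH; last by move=> y yw; rewrite fg // letters_cat mem_cat yw.
by congr (sop _ _); apply: fg; rewrite letters_cat mem_cat mem_head orbT.
Qed.

Definition wpow (w : word) (n : nat) : word := spow (w : word_semigroup) n.

Lemma weval_pow (S : semigroup) (f : nat -> S) w n :
  weval f (wpow w n) = spow (weval f w) n.
Proof. by elim: n => [|n IH] //; rewrite /wpow /= weval_cat IH. Qed.

Definition mult (w : word) : nat -> nat := fun x => count_mem x (letters w).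

Lemma mult_cat u v : mult (wcat u v) = fun x => mult u x + mult v x.
Proof. by apply/funext => x; rewrite /mult letters_cat count_cat. Qed.

Lemma mult_pow w n : mult (wpow w n) = fun x => mult w x * n.+1.
Proof.
elim: n => [|n IH]; first by apply/funext => x; rewrite muln1.
by rewrite mult_cat -/(wpow w n) IH; apply/funext => x; rewrite -mulnS.
Qed.

Lemma mult_perm u v : mult u = mult v -> perm_eq (letters u) (letters v).
Proof. by move=> uv; apply/allP => x _; apply/eqP/(congr1 (@^~ x) uv). Qed.

Lemma mult_gt0 w x : (0 < mult w x) = (x \in letters w).
Proof. by rewrite /mult -has_count has_pred1. Qed.

Lemma weval_perm (S : semigroup) (f : nat -> S) u v :
  COM S -> perm_eq (letters u) (letters v) -> weval f u = weval f v.
Proof.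
(* [oAC] adjoins an identity, so that big operators apply to a semigroup. *)
move=> cS uv; pose op := oAC (@sopA S) cS.
have E w : Some (weval f w) = \big[op/None]_(x <- letters w) Some (f x).
  elim/word_ind_r: w => [x|w x IH]; first by rewrite big_seq1.
  by rewrite letters_cat big_cat -IH big_seq1 weval_cat.
by apply: Some_inj; rewrite !E; exact: perm_big.
Qed.

(** The cofactor of a divisor may be empty, which a word cannot be; hence a list. *)
Definition wext (w : word) (s : seq nat) : word :=
  Word (whead w) (wtail w ++ s).

Lemma letters_ext w s : letters (wext w s) = letters w ++ s.
Proof. by []. Qed.

Lemma mult_leP u w : (forall x, mult u x <= mult w x) ->
  exists s, perm_eq (letters w) (letters (wext u s)).
Proof.
move=> /count_subseqP[t tw ut].
have [s ws] := perm_to_subseq tw; exists s.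
by rewrite (permPl ws) letters_ext perm_cat2r perm_sym.
Qed.

Lemma weval_ext (S : semigroup) (f : nat -> S) u v s :
  weval f u = weval f v -> weval f (wext u s) = weval f (wext v s).
Proof. by rewrite /weval /wext /= !foldl_cat => ->. Qed.

Lemma is_zero_inj (S : semigroup) (y z : S) : is_zero y -> is_zero z -> y = z.
Proof. by move=> /(_ z)[_ yz] /(_ y)[zy _]; rewrite -yz. Qed.

Lemma is_zero_ext (S : semigroup) (f : nat -> S) w s :
  is_zero (weval f w) -> is_zero (weval f (wext w s)).
Proof.
move=> wz; rewrite /weval /wext /= foldl_cat -/(weval f w).
elim: s (weval f w) wz => [|x s IH] a az //=; apply: IH.
by have [_ ->] := az (f x).
Qed.

Lemma is_zero_letter (S : semigroup) (f : nat -> S) w x :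
  x \in letters w -> is_zero (f x) -> is_zero (weval f w).
Proof.
move=> + fx; elim/word_ind_r: w => [y|w y IH].
  by rewrite mem_seq1 => /eqP xy; rewrite xy in fx.
rewrite letters_cat mem_cat mem_seq1 weval_cat => /orP[/IH z|/eqP xy].
  by have [_ ->] := z (f y).
by rewrite xy in fx; have [-> _] := fx (weval f w).
Qed.

(** * Identities of a class *)

Definition holds (V : set semigroup) (e : identity) : Prop :=
  forall S, V S -> satisfies S e.

Definition vanishes (V : set semigroup) (w : word) : Prop :=
  forall (S : semigroup) (f : nat -> S), V S -> is_zero (weval f w).

Lemma holds_sym V u v : holds V (u, v) -> holds V (v, u).
Proof. by move=> uv S VS f; exact/esym/uv. Qed.

Lemma holds_trans V u v w : holds V (u, v) -> holds V (v, w) -> holds V (u, w).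
Proof. by move=> uv vw S VS f; rewrite [LHS]uv //; exact: vw. Qed.

Lemma holds_subst V g u v :
  holds V (u, v) -> holds V (wsubst g u, wsubst g v).
Proof. by move=> uv S VS f; rewrite /= !weval_subst; exact: uv. Qed.

Lemma holds_perm V u v : V `<=` COM ->
  perm_eq (letters u) (letters v) -> holds V (u, v).
Proof. by move=> cV uv S VS f; exact: weval_perm (cV _ VS) uv. Qed.

Lemma holds_vanishes V u v : holds V (u, v) -> vanishes V u -> vanishes V v.
Proof. by move=> uv uz S f VS; rewrite -[weval f v]uv //; exact: uz. Qed.

(** * Direct products and a uniform nilpotency exponent *)

Definition prod_op (F : nat -> semigroup) (a b : forall n, F n) :
  forall n, F n := fun n => sop (a n) (b n).

Lemma prod_opA F : associative (@prod_op F).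
Proof.
by move=> a b c; apply: functional_extensionality_dep => n; exact: sopA.
Qed.

Lemma prod_inhabited (F : nat -> semigroup) : inhabited (forall n, F n).
Proof.
have F1 n : exists x : F n, True by have [x] := carrier_inhabited (F n); exists x.
by constructor => n; exact: sval (cid (F1 n)).
Qed.

Definition prod_semigroup F := MkSemigroup (@prod_opA F) (prod_inhabited F).

Lemma weval_prod F (f : nat -> prod_semigroup F) w n :
  weval f w n = weval (fun x => f x n) w.
Proof.
elim/word_ind_r: w => [x|w x IH] //.
by rewrite !weval_cat -IH.
Qed.

Lemma prod_variety V F : is_variety V -> (forall n, V (F n)) ->
  V (prod_semigroup F).
Proof.
move=> [E ->] VF e Ee f; apply: functional_extensionality_dep => n.
by rewrite !weval_prod; exact: VF.
Qed.

Lemma spow_prod F (x : prod_semigroup F) k n : spow x k n = spow (x n) k.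
Proof. by elim: k => //= k <-. Qed.

(* A direct product of witnesses, one for each exponent, would not be nil. *)
Lemma nil_class_bound V : is_variety V -> nil_class V ->
  exists N, forall (S : semigroup) (x : S), V S -> is_zero (spow x N).
Proof.
move=> vV nV; apply: contrapT => /forallNP noN.
have wit n : exists p : {S : semigroup & S},
    V (projT1 p) /\ ~ is_zero (spow (projT2 p) n).
  have /existsNP[S /existsNP[x /not_implyP[VS xn]]] := noN n.
  by exists (existT _ S x).
have [p pP] := choice wit.
pose F n := projT1 (p n); pose x : prod_semigroup F := fun n => projT2 (p n).
have [z zz /(_ x)[n xn]] : nil_semigroup (prod_semigroup F).
  by apply: nV; apply: (prod_variety vV) => n; have [] := pP n.
have [_] := pP n; apply.
suff -> : spow (projT2 (p n)) n = z n.
  (* The projection is onto: any [a] at coordinate [n] extends to an element of the product. *)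
  move=> a; pose b : prod_semigroup F := fun m =>
    if pselect (n = m) is left e then ecast m (F m) e a else x m.
  have bn : b n = a.
    by rewrite /b; case: pselect => // e; rewrite (Prop_irrelevance e erefl).
  have [zl zr] := zz b; rewrite -bn.
  by split; [exact: (f_equal (fun h : prod_semigroup F => h n) zl)
           | exact: (f_equal (fun h : prod_semigroup F => h n) zr)].
by rewrite -xn spow_prod.
Qed.

Lemma mult_pow_letter x n y : mult (wpow (wletter x) n) y = (x == y) * n.+1.
Proof. by rewrite mult_pow /mult /= addn0. Qed.

(** Up to commutativity, x^(N+1) divides w. *)
Lemma vanishes_pow V N w x : V `<=` COM ->
  (forall (S : semigroup) (x : S), V S -> is_zero (spow x N)) -> N < mult w x ->
  vanishes V w.
Proof.
move=> cV Vnil Nw; have [|s ws] := @mult_leP (wpow (wletter x) N) w.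
  by move=> y; rewrite mult_pow_letter; case: eqP => [<-|]; rewrite ?mul1n.
move=> S f VS; rewrite (weval_perm f (cV _ VS) ws).
by apply: is_zero_ext; rewrite weval_pow; exact: Vnil.
Qed.

(** If a letter of u is missing from v, replacing its value by a zero makes u zero and leaves v
    unchanged. *)
Lemma holds_letters V N u v :
  (forall (S : semigroup) (x : S), V S -> is_zero (spow x N)) -> ~ vanishes V u ->
  holds V (u, v) -> {subset letters u <= letters v}.
Proof.
move=> Vnil nzu uv x xu; apply: contrapT => /negP xv; apply: nzu => S f VS.
pose f' y := if y == x then spow (f x) N else f y.
suff <- : weval f' u = weval f u.
  by apply: is_zero_letter xu _; rewrite /f' eqxx; exact: Vnil.
rewrite [LHS](uv _ VS) [RHS](uv _ VS); apply: eq_in_weval => y yv.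
by rewrite /f'; case: eqP => // yx; rewrite -yx yv in xv.
Qed.

(** * Lengths of divisors and of instances *)

Definition sub_mult (a b : nat -> nat) : Prop := forall x, a x <= b x.

(** The equality case lets a mere length bound identify a divisor with the whole word, up to
    order. *)
Lemma size_sub u v : sub_mult (mult u) (mult v) ->
  size (letters u) <= size (letters v) ?= iff perm_eq (letters u) (letters v).
Proof.
move=> /mult_leP[s vs]; rewrite (permPr vs) (perm_size vs) letters_ext size_cat.
split; first exact: leq_addr.
case: s {vs} => [|x s]; first by rewrite cats0 addn0 eqxx perm_refl.
rewrite -{1}[size _]addn0 eqn_add2l; apply/esym/negP => /perm_size.
by rewrite size_cat => /eqP; rewrite -{1}[size _]addn0 eqn_add2l.
Qed.

Lemma size_le_sumn (T : Type) (h : T -> nat) s : (forall x, 0 < h x) ->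
  size s <= sumn (map h s).
Proof. by move=> h0; elim: s => //= x s IH; rewrite -add1n leq_add. Qed.

Lemma size_lt_sumn (T : Type) (h : T -> nat) s : (forall x, 0 < h x) ->
  (size s < sumn (map h s)) = has (fun x => 1 < h x) s.
Proof.
move=> h0; elim: s => //= x s <-; have := h0 x; have := size_le_sumn s h0.
case: (h x) => [|[|n]] //= le_s _; rewrite ?add1n //.
by rewrite !addSn !ltnS (leq_trans le_s) // leq_addl.
Qed.

Lemma size_subst g w : size (letters (wsubst g w)) =
  sumn [seq size (letters (g x)) | x <- letters w].
Proof. by rewrite letters_subst size_flatten /shape -map_comp. Qed.

(** * Test semigroups: Rees quotients of the free commutative semigroup, and cyclic groups *)

Definition vadd (a b : nat -> nat) : nat -> nat := fun x => a x + b x.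

Lemma vaddA : associative vadd.
Proof. by move=> a b c; apply/funext => x; exact: addnA. Qed.

Lemma vaddC : commutative vadd.
Proof. by move=> a b; apply/funext => x; exact: addnC. Qed.

Definition divisor_closed (P : (nat -> nat) -> Prop) : Prop :=
  forall a b, P (vadd a b) -> P a.

(** A word up to commutativity is its multiplicity function. On these, this is the Rees quotient by
    the ideal where [P] fails. *)
Definition div_op P (a b : option (nat -> nat)) : option (nat -> nat) :=
  obind (fun a' => obind (fun b' =>
    if `[< P (vadd a' b') >] then Some (vadd a' b') else None) b) a.

Lemma div_opC P : commutative (div_op P).
Proof. by move=> [a|] [b|] //=; rewrite vaddC. Qed.

Lemma div_opA P : divisor_closed P -> associative (div_op P).
Proof.
move=> dP; have E a b c : div_op P (Some a) (div_op P (Some b) (Some c)) =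
    if `[< P (vadd a (vadd b c)) >] then Some (vadd a (vadd b c)) else None.
  rewrite /=; case: (asboolP (P (vadd b c))) => //= nP.
  by case: asboolP => //; rewrite vaddC => /dP.
move=> [a|] [b|] [c|] //; last first.
- by rewrite /=; case: asboolP.
by rewrite E [RHS]div_opC E (vaddC c) vaddA.
Qed.

(* [None] is the zero; the empty product is not the [mult] of a word, so that *)
(* the semigroup has no identity element.                                     *)
Definition div_ok P (o : option (nat -> nat)) : Prop :=
  if o is Some a then P a /\ exists w, a = mult w else True.

Lemma div_op_ok P a b : div_ok P a -> div_ok P b -> div_ok P (div_op P a b).
Proof.
case: a b => [a|] [b|] //= [_ [u ->]] [_ [v ->]].
by case: asboolP => //= Puv; split=> //; exists (wcat u v); rewrite mult_cat.
Qed.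

Definition div_mul P (a b : {o | div_ok P o}) : {o | div_ok P o} :=
  exist _ (div_op P (sval a) (sval b)) (div_op_ok (svalP a) (svalP b)).

Lemma sval_inj T (P : T -> Prop) (a b : {x | P x}) : sval a = sval b -> a = b.
Proof. by case: a b => a Pa [b Pb] /= ab; exact: eq_exist. Qed.

Lemma div_mulA P : divisor_closed P -> associative (@div_mul P).
Proof. by move=> dP a b c; apply: sval_inj; exact: div_opA. Qed.

Definition div_elt P (o : option (nat -> nat)) : {o | div_ok P o} :=
  if pselect (div_ok P o) is left h then exist _ o h else exist _ None I.

Definition div_semigroup P (dP : divisor_closed P) :=
  MkSemigroup (div_mulA dP) (inhabits (div_elt P None)).

Lemma div_semigroup_com P (dP : divisor_closed P) : COM (div_semigroup dP).
Proof. by move=> a b; apply: sval_inj; exact: div_opC. Qed.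

(** [w0] stands in for the zero, which is the [mult] of no word; [divisors_mono] needs a particular
    choice of it. *)
Lemma div_repr P (dP : divisor_closed P) (f : nat -> div_semigroup dP) w0 :
  exists g : nat -> word,
    (forall x a, sval (f x) = Some a -> a = mult (g x)) /\
    (forall x, sval (f x) = None -> g x = w0).
Proof.
have /choice[g gP] x : exists w,
    (forall a, sval (f x) = Some a -> a = mult w) /\
    (sval (f x) = None -> w = w0).
  case: (f x) => -[a|] /=; last by exists w0.
  by move=> [_ [w aw]]; exists w; split => // _ [<-].
by exists g; split=> x; have [] := gP x.
Qed.

Lemma weval_div P (dP : divisor_closed P) (f : nat -> div_semigroup dP) g w :
  (forall x a, sval (f x) = Some a -> a = mult (g x)) ->
  sval (weval f w) =
  if all (fun x => isSome (sval (f x))) (letters w) &&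
     `[< P (mult (wsubst g w)) >] then Some (mult (wsubst g w)) else None.
Proof.
move=> fg; elim/word_ind_r: w => [x|w x IH].
  rewrite /= andbT /weval /wsubst /weval /=; have := fg x.
  case: (f x) => -[a|] //= [Pa _] /(_ _ erefl) <-.
  by case: asboolP.
rewrite weval_cat letters_cat all_cat wsubst_cat mult_cat.
case: (all _ (letters w)) IH => IH; rewrite /= IH //= andbT.
have := fg x; rewrite /weval /= -/(wsubst g w) -/(vadd _ _).
case: (f x) => -[a|] /= _ => [/(_ _ erefl) ->|_]; last by case: ifP.
case: (asboolP (P (mult (wsubst g w)))) => //= nP.
by case: asboolP => // Puv; case: nP; exact: dP Puv.
Qed.

(* The carrier is not ['I_N.+1], whose universe is too large for [carrier].   *)
Definition cyclic_elt N (n : nat) : {i | i < N.+1} :=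
  exist _ (n %% N.+1) (ltn_pmod n (ltn0Sn N)).

Definition cyclic_add N (a b : {i | i < N.+1}) : {i | i < N.+1} :=
  cyclic_elt N (sval a + sval b).

Lemma cyclic_addA N : associative (@cyclic_add N).
Proof.
by move=> a b c; apply: sval_inj; rewrite /= modnDml modnDmr addnA.
Qed.

Definition cyclic_semigroup N :=
  MkSemigroup (@cyclic_addA N) (inhabits (cyclic_elt N 0)).

Lemma cyclic_com N : COM (cyclic_semigroup N).
Proof. by move=> a b; apply: sval_inj; rewrite /= addnC. Qed.

(** In a group of order N+1, a^(N+2) = a. *)
Lemma cyclic_pow N u : satisfies (cyclic_semigroup N) (u, wpow u N.+1).
Proof.
move=> f; rewrite [RHS]weval_pow -[LHS]/(weval f u); move: (weval f u) => a.
have E n : sval (spow (S := cyclic_semigroup N) a n) = sval a * n.+1 %% N.+1.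
  elim: n => [|n IH]; first by rewrite muln1 modn_small //; exact: svalP a.
  by rewrite /= -/(spow _ n) IH modnDmr -mulnS.
apply: sval_inj; rewrite E mulnS -modnDmr modnMl addn0 modn_small //.
exact: svalP a.
Qed.

(** Sending x to 1 and all other letters to 0 counts x modulo N+1. *)
Lemma cyclic_mult N u v x : satisfies (cyclic_semigroup N) (u, v) ->
  mult u x = mult v x %[mod N.+1].
Proof.
pose f y : cyclic_semigroup N := cyclic_elt N (y == x).
have E w : sval (weval f w) = mult w x %% N.+1.
  elim/word_ind_r: w => [y|w y IH]; first by rewrite /mult /= addn0.
  by rewrite weval_cat mult_cat /= IH modnDm /mult /= addn0.
by move=> /(_ f) /(congr1 sval); rewrite /= !E.
Qed.

(** * Divisors of a word *)

Definition embeds (u v : word) : Prop :=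
  exists g, sub_mult (mult (wsubst g u)) (mult v).

Definition divides (v : word) (a : nat -> nat) : Prop := sub_mult a (mult v).

Definition properly_divides (v : word) (a : nat -> nat) : Prop :=
  divides v a /\ a <> mult v.

Lemma divides_closed v : divisor_closed (divides v).
Proof. by move=> a b ab x; apply: leq_trans (ab x); exact: leq_addr. Qed.

Lemma properly_divides_closed v : divisor_closed (properly_divides v).
Proof.
move=> a b [abv abn]; split=> [|av]; first exact: divides_closed abv.
apply: abn; apply/funext => x; apply/eqP.
by rewrite eqn_leq abv -av leq_addr.
Qed.

Definition divisors v := div_semigroup (@divides_closed v).
Definition proper_divisors v := div_semigroup (@properly_divides_closed v).

Lemma div_pow_zero P (dP : divisor_closed P) (a : div_semigroup dP) n :
  sval a = None -> a = spow a n.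
Proof.
by move=> a0; elim: n => //= n <-; apply: sval_inj; rewrite /= a0.
Qed.

(** A nonzero value of u would be an instance of u dividing v; so u is always zero, and zero equals
    its powers. *)
Lemma div_unembedded v P (dP : divisor_closed P) u n :
  (forall a, P a -> divides v a) -> ~ embeds u v ->
  satisfies (div_semigroup dP) (u, wpow u n).
Proof.
move=> Pv uv f; rewrite /= weval_pow; apply: div_pow_zero.
have [g [fg _]] := div_repr f (wletter 0).
rewrite (weval_div u fg); case: ifP => // /andP[_ /asboolP /Pv gu].
by case: uv; exists g.
Qed.

Lemma size_subst_ge g w : size (letters w) <= size (letters (wsubst g w)).
Proof. by rewrite size_subst; exact: size_le_sumn. Qed.

(** An instance of v is at least as long as v, so it is never a proper divisor: v takes only the
    value zero. *)
Lemma proper_divisors_pow v n : satisfies (proper_divisors v) (v, wpow v n).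
Proof.
move=> f; rewrite /= weval_pow; apply: div_pow_zero.
have [g [fg _]] := div_repr f (wletter 0).
rewrite (weval_div v fg); case: ifP => // /andP[_ /asboolP[gv []]].
apply/funext => x; apply/permP; rewrite -(geq_leqif (size_sub gv)).
exact: size_subst_ge.
Qed.

(** Send each letter of v to itself: v evaluates to itself, but its higher powers do not divide
    it. *)
Lemma divisors_pow v n : 0 < n -> ~ satisfies (divisors v) (v, wpow v n).
Proof.
move=> n0; pose f x : divisors v := div_elt _ (Some (mult (wletter x))).
have fv x : x \in letters v -> sval (f x) = Some (mult (wletter x)).
  move=> xv; rewrite /f /div_elt; case: pselect => // -[]; split; last first.
    by exists (wletter x).
  by move=> y; rewrite /mult /= addn0; case: eqP => // <-; rewrite mult_gt0.
have fg x a : sval (f x) = Some a -> a = mult (wletter x).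
  by rewrite /f /div_elt; case: pselect => //= _ [].
have subst1 w : wsubst wletter w = w.
  elim/word_ind_r: w => // w x IH.
  by rewrite wsubst_cat IH.
move=> /(_ f) /(congr1 sval); rewrite /= (weval_div v fg) (weval_div _ fg) !subst1.
rewrite [X in X && _](_ : _ = true); last by apply/allP => x /fv ->.
rewrite [X in if X then _ else _](_ : _ = true); last by apply/asboolP.
case: ifP => // _ [] /(congr1 (@^~ (whead v))); rewrite mult_pow => vn.
have : 0 < mult v (whead v) by rewrite mult_gt0 mem_head.
by move=> /(ltn_Pmulr (n0 : 1 < n.+1)); rewrite -vn ltnn.
Qed.

(** If the value of p is v, then V keeps the exponents of the corresponding instance of q below N+1
    and the cyclic group fixes them modulo N+1. Otherwise p is evaluated entirely among proper
    divisors. *)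
Lemma divisors_mono V N v p q : V `<=` COM ->
  (forall (S : semigroup) (x : S), V S -> is_zero (spow x N)) ->
  ~ vanishes V v -> holds V (p, q) ->
  satisfies (cyclic_semigroup N) (p, q) ->
  satisfies (proper_divisors v) (p, q) ->
  forall (f : nat -> divisors v) a,
    sval (weval f p) = Some a -> sval (weval f q) = Some a.
Proof.
move=> cV Vnil nzv pq cpq dpq f a.
(* Zero values are represented by a word with N+1 occurrences of one letter, too many to divide a
   word that is nonzero in V. This detects letters of q with value zero. *)
have [g [fg fg0]] := div_repr f (wpow (wletter 0) N).
rewrite (weval_div p fg) (weval_div q fg); case: ifP => // /andP[fp].
move=> /asboolP gpv [ap]; have [av|av] := pselect (a = mult v).
  have vq : holds V (v, wsubst g q).
    apply: holds_trans (holds_subst g pq); apply: holds_perm cV _.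
    by apply: mult_perm; rewrite ap.
  have ltN x w : holds V (v, w) -> mult w x < N.+1.
    move=> vw; rewrite ltnS leqNgt; apply/negP => Nw; apply: nzv.
    exact: holds_vanishes (holds_sym vw) (vanishes_pow cV Vnil Nw).
  have qv : mult (wsubst g q) = mult v.
    apply/funext => x; rewrite -[LHS](@modn_small _ N.+1) ?ltN //.
    rewrite -[RHS](@modn_small _ N.+1) ?ltN // -av -ap.
    apply/esym/cyclic_mult => h; rewrite /= !weval_subst; exact: cpq.
  rewrite qv -av asboolT ?andbT; last by rewrite av.
  case: allP => // nall; case: nall => x xq.
  case fx: (sval (f x)) => [//|]; have := ltN 0 _ vq.
  rewrite ltnNge; case/negP.
  have gx := fg0 _ fx.
  have -> : N.+1 = mult (g x) 0 by rewrite gx mult_pow_letter mul1n.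
  rewrite /mult letters_subst count_flatten -map_comp.
  by rewrite (perm_sumn (perm_map _ (perm_to_rem xq))) /= leq_addr.
(* Values that are not proper divisors become zero. Letters of p keep their values, which divide the
   proper divisor [a]. *)
pose f' x : proper_divisors v := div_elt _ (sval (f x)).
have f'g x b : sval (f' x) = Some b -> b = mult (g x).
  by rewrite /f' /div_elt; case: pselect => //= _; exact: fg.
have f'f x : sval (f' x) -> sval (f x).
  by rewrite /f' /div_elt; case: pselect => //=.
have gpv' : properly_divides v (mult (wsubst g p)) by split=> //; rewrite ap.
have := dpq f'; move=> /(congr1 sval).
rewrite (weval_div p f'g) (weval_div q f'g) (asboolT gpv') andbT.
rewrite [X in if X then _ else _](_ : _ = true); last first.
  apply/allP => x xp; have := allP fp _ xp.
  rewrite /f' /div_elt; case: pselect => // nok.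
  case fx: (sval (f x)) => [b|] // _; case: nok; rewrite fx /=.
  have bg := fg _ _ fx; split; last by exists (g x).
  have [s ps] : exists s, perm_eq (letters (wsubst g p)) (letters (wext (g x) s)).
    apply: mult_leP => y; rewrite /mult letters_subst count_flatten -map_comp.
    by rewrite (perm_sumn (perm_map _ (perm_to_rem xp))) /= leq_addr.
  apply: (@properly_divides_closed v b (fun y => count_mem y s)).
  suff -> : vadd b (fun y => count_mem y s) = mult (wsubst g p) by [].
  apply/funext => y; rewrite bg /vadd /mult (permP ps) letters_ext.
  by rewrite count_cat.
case: ifP => // /andP[fq /asboolP[gqv _]] [pq_eq].
rewrite asboolT // andbT -pq_eq ap (_ : all _ (letters q) = true) //.
by apply/allP => x xq; exact: f'f (allP fq x xq).
Qed.

Lemma divisors_satisfies V N v p q : V `<=` COM ->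
  (forall (S : semigroup) (x : S), V S -> is_zero (spow x N)) ->
  ~ vanishes V v -> holds V (p, q) ->
  satisfies (cyclic_semigroup N) (p, q) ->
  satisfies (proper_divisors v) (p, q) -> satisfies (divisors v) (p, q).
Proof.
move=> cV Vnil nzv pq cpq dpq f; apply: sval_inj.
have pq1 := divisors_mono cV Vnil nzv pq cpq dpq (f := f).
have qp1 : forall a, sval (weval f q) = Some a -> sval (weval f p) = Some a.
  apply: (divisors_mono cV Vnil nzv (holds_sym pq)) => h.
    exact/esym/cpq.
  exact/esym/dpq.
rewrite /=; case ep: (sval (weval f p)) => [a|]; first exact/esym/pq1.
by case eq: (sval (weval f q)) => [a|] //; rewrite -ep; apply: qp1.
Qed.

(** * Use of the modular law *)

Lemma com_class_variety E : is_variety (COM `&` Mod E).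
Proof. by apply: setI_is_variety COM_is_variety _; exists E. Qed.

Definition com_class E : comVariety :=
  ComVariety (com_class_variety E) (@subIsetl _ COM (Mod E)).

Lemma modular_embeds (V : comVariety) N u v : modular_element V ->
  (forall (S : semigroup) (x : S), cv_class V S -> is_zero (spow x N)) ->
  holds V (u, v) -> ~ vanishes V v -> embeds u v.
Proof.
move=> modV Vnil uv nzv; apply: contrapT => nuv.
pose eu := (u, wpow u N.+1); pose ev := (v, wpow v N.+1).
pose Z := com_class [set eu]; pose Y := com_class [set eu; ev].
have cV := @cv_com V.
have YZ : (Y <= Z)%O.
  by apply/cv_leP => S [cS YS]; split=> // e ->; apply: YS; left.
have pow0 w : vanishes V (wpow w N.+1).
  move=> S f VS; rewrite weval_pow; move: (weval f w) => a.
  by have z := Vnil S a VS; have [/= az _] := z a; rewrite az.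
(* By modularity this variety is the join of V meet Z with Y, where v = v^(N+2) holds; [divisors v]
   violates it. *)
have dS : cv_class ((V `|` Y) `&` Z)%O (divisors v).
  rewrite cv_meetE cv_joinE; split; last first.
    split; first exact: div_semigroup_com.
    by move=> e ->; exact: (@div_unembedded v).
  move=> W [[F ->] VW YW] [p q] Fpq.
  apply: divisors_satisfies cV Vnil nzv _ _ _.
  - by move=> S VS; exact: VW.
  - apply: (YW (cyclic_semigroup N)) Fpq; split; first exact: cyclic_com.
    by move=> e [->|->]; exact: cyclic_pow.
  - apply: (YW (proper_divisors v)) Fpq; split; first exact: div_semigroup_com.
    move=> e [->|->]; last exact: proper_divisors_pow.
    by apply: (@div_unembedded v) => // a [].
move: dS; rewrite (modV _ _ YZ) cv_joinE => dS.
apply: (@divisors_pow v N.+1) => //.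
apply: (dS (Mod [set ev])) => //; split; first by exists [set ev].
  move=> S [VS [_ ZS]] _ -> f.
  rewrite [LHS]/= -[LHS](uv _ VS) [LHS](ZS eu) //=.
  by apply: is_zero_inj; exact: pow0.
by move=> S [_ YS] e ->; apply: YS; right.
Qed.

(** * From embeddings to renamings *)

Lemma holds_ext V u v s : holds V (u, v) -> holds V (wext u s, wext v s).
Proof. by move=> uv S VS f; apply: weval_ext; exact: uv. Qed.

Lemma sumn_le_size (T : Type) (h : T -> nat) N s : (forall x, h x <= N) ->
  sumn (map h s) <= size s * N.
Proof. by move=> hN; elim: s => //= x s IH; rewrite mulSn leq_add. Qed.

(** Being nonzero in V, w has only letters of u, each at most N times. *)
Lemma holds_size_bound V N u w : V `<=` COM ->
  (forall (S : semigroup) (x : S), V S -> is_zero (spow x N)) ->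
  ~ vanishes V u -> holds V (u, w) ->
  size (letters w) <= size (undup (letters u)) * N.
Proof.
move=> cV Vnil nzu uw.
have nzw : ~ vanishes V w by move/(holds_vanishes (holds_sym uw)).
have wN x : mult w x <= N.
  by rewrite leqNgt; apply/negP => /(vanishes_pow cV Vnil).
rewrite -(perm_size (perm_count_undup (letters w))) size_flatten /shape -map_comp.
rewrite (eq_map (g := mult w)); last by move=> x; exact: size_nseq.
apply: leq_trans (sumn_le_size _ wN) _; rewrite leq_mul //.
apply: uniq_leq_size; first exact: undup_uniq.
move=> x; rewrite !mem_undup.
exact: holds_letters Vnil nzw (holds_sym uw) x.
Qed.

(* If [v] were longer than [u], the embedding could be iterated to produce    *)
(* arbitrarily long words equal to [u] in [V].                                *)
Lemma embeds_size V N u v : V `<=` COM ->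
  (forall (S : semigroup) (x : S), V S -> is_zero (spow x N)) ->
  ~ vanishes V u -> holds V (u, v) -> embeds u v ->
  size (letters v) <= size (letters u).
Proof.
move=> cV Vnil nzu uv [g /mult_leP[s vs]]; rewrite leqNgt; apply/negP => uv_size.
have g0 x : 0 < size (letters (g x)) by [].
suff grow k : exists2 w, holds V (u, w) & k <= size (letters w).
  have [w uw] := grow (size (undup (letters u)) * N).+1.
  by rewrite ltnNge (holds_size_bound cV Vnil nzu uw).
elim: k => [|k [w uw kw]]; first by exists u.
exists (wext (wsubst g w) s).
  apply: (holds_trans uv); apply: (holds_trans (holds_perm cV vs)).
  exact/holds_ext/holds_subst.
apply: leq_ltn_trans kw _; rewrite letters_ext size_cat.
(* As v is longer than u, either [s] is nonempty or [g] lengthens a letter of u; that letter also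
   occurs in [w]. *)
have := uv_size; rewrite (perm_size vs) letters_ext size_cat !size_subst.
case: s {vs} => [|x s]; last first.
  move=> _; rewrite [size (_ :: _)]/= addnS ltnS.
  exact: leq_trans (size_le_sumn (letters w) g0) (leq_addr _ _).
rewrite !addn0 !size_lt_sumn // => /hasP[x xu gx]; apply/hasP; exists x => //.
exact: holds_letters Vnil nzu uw x xu.
Qed.

Lemma uniq_map_inj_in (T1 T2 : eqType) (f : T1 -> T2) s :
  uniq (map f s) -> {in s &, injective f}.
Proof.
elim: s => //= x s IH /andP[fx /IH fs] y z; rewrite !inE.
move=> /orP[/eqP->|ys] /orP[/eqP->|zs] // fyz; last exact: fs.
  by rewrite fyz map_f in fx.
by rewrite -fyz map_f in fx.
Qed.

(** The lengths satisfy |u| <= |g(u)| <= |v| <= |u|, so g sends letters of u to letters and g(u) is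
    v up to order. *)
Lemma embeds_renaming u v : letters u =i letters v -> embeds u v ->
  size (letters v) <= size (letters u) ->
  exists2 r, {in letters u &, injective r} &
    perm_eq (letters v) (letters (wmap r u)).
Proof.
move=> uv [g gu] vu; pose r x := whead (g x).
have gE : letters (wsubst g u) = letters (wmap r u).
  rewrite letters_subst (_ : letters (wmap r u) = map r (letters u)) //.
  rewrite -[RHS]flatten_map1; congr flatten; apply/eq_in_map => x xu.
  have : ~~ (size (letters u) < size (letters (wsubst g u))).
    by rewrite -leqNgt; apply: leq_trans vu; exact: size_sub gu.
  rewrite size_subst size_lt_sumn // => /hasPn /(_ x xu).
  by rewrite /r; case: (g x) => y [].
have vr : perm_eq (letters v) (letters (wmap r u)).
  rewrite -gE perm_sym -(geq_leqif (size_sub gu)).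
  exact: leq_trans vu (size_subst_ge g u).
(* [r] maps the finite set of letters of u onto that of v, which is the same set; so it is
   injective. *)
exists r => // x y xu yu; rewrite -(mem_undup (letters u)) in xu.
rewrite -(mem_undup (letters u)) in yu; apply: uniq_map_inj_in xu yu.
apply: (leq_size_uniq (undup_uniq (letters u))); last by rewrite size_map.
move=> z; rewrite mem_undup uv (perm_mem vr).
by move=> /(@mapP _ _ r (letters u))[t tu ->]; rewrite map_f ?mem_undup.
Qed.

(** * Symbolic identities w = 0 and the conclusion *)

Lemma fresh_letter w : exists x, x \notin letters w.
Proof.
exists (sumn (letters w)).+1; apply/negP => /perm_to_rem /perm_sumn /= E.
by have := leq_addr (sumn (rem (sumn (letters w)).+1 (letters w)))
  (sumn (letters w)).+1; rewrite -E ltnn.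
Qed.

(** A fresh letter can take any value without changing that of w. *)
Lemma vanishes_expand V w : vanishes V w <-> V `<=` Mod (expand (Zero w)).
Proof.
split=> [wz S VS e [x xw [->|->]] f|Vw S f VS a].
- by rewrite /= weval_cat; have [_ ->] := wz S f VS (weval f (wletter x)).
- by rewrite /= weval_cat; have [-> _] := wz S f VS (weval f (wletter x)).
have [x xw] := fresh_letter w; pose f' y := if y == x then a else f y.
have f'w : weval f' w = weval f w.
  apply: eq_in_weval => y yw; rewrite /f'; case: eqP => // yx.
  by rewrite -yx yw in xw.
have f'x : weval f' (wletter x) = a by rewrite /weval /= /f' eqxx.
split.
  have /(_ f') := Vw S VS (wcat (wletter x) w, w) (ex_intro2 _ _ x xw (or_intror erefl)).
  by rewrite /= weval_cat f'w f'x.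
have /(_ f') := Vw S VS (wcat w (wletter x), w) (ex_intro2 _ _ x xw (or_introl erefl)).
by rewrite /= weval_cat f'w f'x.
Qed.

Unset Implicit Arguments.

Theorem theorem1p5 (V : comVariety) (nilV : nil_class V)
    (modV : modular_element V) :
  exists Sigma : set symbolic_identity,
    (forall s, Sigma s -> zero_reduced s \/ substitutive s) /\
    (V : set semigroup) = COM `&` Mod (\bigcup_(s in Sigma) expand s).
Proof.
have [N Vnil] := nil_class_bound (cv_variety V) nilV.
have cV := @cv_com V.
exists [set s | (zero_reduced s \/ substitutive s) /\ V `<=` Mod (expand s)].
split=> [s []//|]; apply/seteqP; split=> [S VS|S [cS SS]].
  by split; [exact: cV | move=> e [s [_ /(_ S VS) Ss] /Ss]].
have [E VE] := cv_variety V; rewrite VE => -[u v] Euv.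
have uv : holds V (u, v) by move=> T; rewrite VE; apply.
have [uz|nzu] := pselect (vanishes V u).
  have S0 w : vanishes V w -> vanishes [set S] w.
    move=> /vanishes_expand Vw; apply/vanishes_expand => _ -> e we; apply: SS.
    by exists (Zero w) => //; split=> //; left; exists w.
  move=> f; apply: is_zero_inj; first exact: S0.
  exact: S0 (holds_vanishes uv uz) _ _ _.
have nzv : ~ vanishes V v by move/(holds_vanishes (holds_sym uv)).
have uvE := modular_embeds modV Vnil uv nzv.
have uv_letters : letters u =i letters v.
  move=> x; apply/idP/idP; first exact: holds_letters Vnil nzu uv x.
  exact: holds_letters Vnil nzv (holds_sym uv) x.
have [r r_inj vr] := embeds_renaming uv_letters uvE
  (embeds_size cV Vnil nzu uv uvE).
(* [v] may list its letters in another order than [wmap r u]; only the latter gives a substitutive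
   identity by letterwise renaming. *)
have Sur : satisfies S (u, wmap r u).
  apply: SS; exists (Id (u, wmap r u)) => //; split.
    right; exists u, (wmap r u); split=> //; last by exists r.
    by move=> x; rewrite uv_letters (perm_mem vr).
  move=> T VT _ -> f; rewrite [LHS](uv T VT f).
  exact: weval_perm (cV _ VT) vr.
by move=> f; rewrite [LHS]Sur; apply/esym/weval_perm.
Qed.
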